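(* Let $K\ge 2$ and $N\ge 2$ be integers and $\mathcal K=\{1,\dots,K\}$. For $i,j\in\mathcal K$ let $\hat{\boldsymbol h}_{i,j}\in\mathbb C^{N}$, let $\boldsymbol B_{i,j}\in\mathbb C^{N\times N}$ be Hermitian with $\boldsymbol B_{i,j}\succeq \boldsymbol 0$, and let $\sigma_i>0$, $\delta_i>0$, $\gamma_i>0$, $\eta_i>0$, $\zeta_i\in(0,1]$. Consider the robust problem (P1): minimize $\sum_{i=1}^K \boldsymbol w_i^H\boldsymbol w_i$ over $\boldsymbol w_i\in\mathbb C^N$ and $\rho_i\in[0,1]$ ($i\in\mathcal K$) subject to, for every $i\in\mathcal K$, $$\frac{|(\hat{\boldsymbol h}_{i,i}+\boldsymbol e_{i,i})^H\boldsymbol w_i|^2}{\sum_{j\ne i}|(\hat{\boldsymbol h}_{i,j}+\boldsymbol e_{i,j})^H\boldsymbol w_j|^2+\sigma_i^2+\delta_i^2/\rho_i}\ge\gamma_i,$$ $$\zeta_i(1-\rho_i)\Big(\sum_{j=1}^K|(\hat{\boldsymbol h}_{i,j}+\boldsymbol e_{i,j})^H\boldsymbol w_j|^2+\sigma_i^2\Big)\ge\eta_i,$$ for all $\boldsymbol e_{i,1},\dots,\boldsymbol e_{i,K}\in\mathbb C^N$ with $\boldsymbol e_{i,j}^H\boldsymbol B_{i,j}\boldsymbol e_{i,j}\le 1$ for each $j\in\mathcal K$. Consider also the rank-constrained semidefinite program (P2): minimize $\sum_{i=1}^K\mathrm{tr}(\boldsymbol W_i)$ over Hermitian $\boldsymbol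 W_i\in\mathbb C^{N\times N}$ and real $\rho_i,\nu_i,\lambda_{i,j},\mu_{i,j},\bar t_{i,j},\underline t_{i,j}$ ($i,j\in\mathcal K$) subject to $$\begin{bmatrix}\rho_i&\delta_i&\boldsymbol 0\\ \delta_i&\frac{\hat{\boldsymbol h}_{i,i}^H\boldsymbol W_i\hat{\boldsymbol h}_{i,i}}{\gamma_i}-\sum_{j\ne i}\bar t_{i,j}-\sigma_i^2-\nu_i&\frac{\hat{\boldsymbol h}_{i,i}^H\boldsymbol W_i}{\gamma_i}\\ \boldsymbol 0&\frac{\boldsymbol W_i\hat{\boldsymbol h}_{i,i}}{\gamma_i}&\frac{\boldsymbol W_i}{\gamma_i}+\nu_i\boldsymbol B_{i,i}\end{bmatrix}\succeq\boldsymbol 0\quad\forall i\in\mathcal K,$$ $$\begin{bmatrix}-\boldsymbol W_j+\lambda_{i,j}\boldsymbol B_{i,j}&-\boldsymbol W_j\hat{\boldsymbol h}_{i,j}\\-\hat{\boldsymbol h}_{i,j}^H\boldsymbol W_j&\bar t_{i,j}-\hat{\boldsymbol h}_{i,j}^H\boldsymbol W_j\hat{\boldsymbol h}_{i,j}-\lambda_{i,j}\end{bmatrix}\succeq\boldsymbol 0\quad\forall i,j\in\mathcal K,$$ $$\begin{bmatrix}\zeta_i(1-\rho_i)&\sqrt{\eta_i}\\ \sqrt{\eta_i}&\sum_{j=1}^K\underline t_{i,j}+\sigma_i^2\end{bmatrix}\succeq\boldsymbol 0\quad\forall i\in\mathcal K,$$ $$\begin{bmatrix}\boldsymbol W_j+\mu_{i,j}\boldsymbol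 B_{i,j}&\boldsymbol W_j\hat{\boldsymbol h}_{i,j}\\ \hat{\boldsymbol h}_{i,j}^H\boldsymbol W_j&\hat{\boldsymbol h}_{i,j}^H\boldsymbol W_j\hat{\boldsymbol h}_{i,j}-\underline t_{i,j}-\mu_{i,j}\end{bmatrix}\succeq\boldsymbol 0\quad\forall i,j\in\mathcal K,$$ $$\lambda_{i,j},\mu_{i,j},\bar t_{i,j},\underline t_{i,j}\ge0,\quad \nu_i\ge0,\quad 0\le\rho_i\le1,\quad \boldsymbol W_i\succeq\boldsymbol 0,\quad \mathrm{rank}(\boldsymbol W_i)=1\quad\forall i,j\in\mathcal K.$$ Then (P2) is an equivalent reformulation of (P1) under $\boldsymbol W_i=\boldsymbol w_i\boldsymbol w_i^H$: a tuple $(\boldsymbol w_i,\rho_i)_{i\in\mathcal K}$ is feasible for (P1) if and only if there exist real numbers $\nu_i,\lambda_{i,j},\mu_{i,j},\bar t_{i,j},\underline t_{i,j}$ such that $(\boldsymbol W_i=\boldsymbol w_i\boldsymbol w_i^H,\rho_i,\nu_i,\lambda_{i,j},\mu_{i,j},\bar t_{i,j},\underline t_{i,j})_{i,j\in\mathcal K}$ is feasible for (P2); and the two objective values then coincide.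
   Context: $(\cdot)^H$ denotes conjugate transpose, and $\boldsymbol A\succeq\boldsymbol 0$ means that $\boldsymbol A$ is Hermitian positive semidefinite. When $\rho_i=0$, the quantity $\delta_i^2/\rho_i$ is read as $+\infty$, so that the left-hand side of the first constraint of (P1) is $0$. *)

(* Defs.v *)
From mathcomp Require Import all_boot all_order all_algebra.
From mathcomp Require Import reals.
From mathcomp Require Export complex.
Set Implicit Arguments.
Unset Strict Implicit.
Unset Printing Implicit Defensive.
Import Order.TTheory GRing.Theory Num.Theory.
Import ComplexField.
Local Open Scope ring_scope.
Local Open Scope complex_scope.
Local Open Scope sesquilinear_scope.

(* [M ^t*] is the conjugate transpose; [0 <= z] in [R[i]] means that [z] is
   real and nonnegative. *)
Definition psd (R : realType) (n : nat) (A : 'M[R[i]]_n) : Prop :=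
  A \is hermsymmx /\ forall x : 'cV[R[i]]_n, 0 <= (x^t* *m A *m x) 0 0.

(* The channel gain |h^H w|^2, as a real number. *)
Definition gain (R : realType) (N : nat) (h w : 'cV[R[i]]_N) : R :=
  Normc.normc ((h^t* *m w) 0 0) ^+ 2.

(* The left-hand side of the first constraint of (P1), for actual channels
   [h i j].  The case [rho i = 0] is singled out because there
   [delta i ^+ 2 / rho i] must be read as +oo, not as the value 0 that the
   library gives to a division by 0. *)
Definition sinr (R : realType) (K N : nat)
    (h : 'I_K -> 'I_K -> 'cV[R[i]]_N) (sigma delta : 'I_K -> R)
    (w : 'I_K -> 'cV[R[i]]_N) (rho : 'I_K -> R) (i : 'I_K) : R :=
  if rho i == 0 then 0
  else gain (h i i) (w i) /
       (\sum_(j < K | j != i) gain (h i j) (w j)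
        + sigma i ^+ 2 + delta i ^+ 2 / rho i).

Definition harvested (R : realType) (K N : nat)
    (h : 'I_K -> 'I_K -> 'cV[R[i]]_N) (sigma zeta : 'I_K -> R)
    (w : 'I_K -> 'cV[R[i]]_N) (rho : 'I_K -> R) (i : 'I_K) : R :=
  zeta i * (1 - rho i) * (\sum_(j < K) gain (h i j) (w j) + sigma i ^+ 2).

Definition P1_objective (R : realType) (K N : nat)
    (w : 'I_K -> 'cV[R[i]]_N) : R[i] :=
  \sum_(i < K) ((w i)^t* *m w i) 0 0.

(* Only the errors of receiver [i] occur in its two constraints, so they are
   quantified as a family [e] indexed by the transmitter [j]. *)
Definition P1_feasible (R : realType) (K N : nat)
    (h : 'I_K -> 'I_K -> 'cV[R[i]]_N) (B : 'I_K -> 'I_K -> 'M[R[i]]_N)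
    (sigma delta gamma eta zeta : 'I_K -> R)
    (w : 'I_K -> 'cV[R[i]]_N) (rho : 'I_K -> R) : Prop :=
  (forall i, 0 <= rho i <= 1) /\
  (forall (i : 'I_K) (e : 'I_K -> 'cV[R[i]]_N),
     (forall j, ((e j)^t* *m B i j *m e j) 0 0 <= 1) ->
     let he := fun k j => h k j + e j in
     gamma i <= sinr he sigma delta w rho i /\
     eta i <= harvested he sigma zeta w rho i).

Definition sinr_lmi (R : realType) (N : nat)
    (h : 'cV[R[i]]_N) (B W : 'M[R[i]]_N)
    (rho delta gamma sigma nu interf : R) : 'M[R[i]]_(1 + (1 + N)) :=
  block_mx
    rho%:C%:M                 (row_mx delta%:C%:M 0)
    (col_mx delta%:C%:M 0)
      (block_mx
         (gamma^-1%:C *: (h^t* *m W *m h) - (interf + sigma ^+ 2 + nu)%:C%:M)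
                                   (gamma^-1%:C *: (h^t* *m W))
         (gamma^-1%:C *: (W *m h)) (gamma^-1%:C *: W + nu%:C *: B)).

Definition upper_lmi (R : realType) (N : nat)
    (h : 'cV[R[i]]_N) (B W : 'M[R[i]]_N) (lambda tbar : R) :
    'M[R[i]]_(N + 1) :=
  block_mx
    (- W + lambda%:C *: B) (- (W *m h))
    (- (h^t* *m W))        (tbar%:C%:M - h^t* *m W *m h - lambda%:C%:M).

Definition energy_lmi (R : realType) (zeta rho eta sigma power : R) :
    'M[R[i]]_(1 + 1) :=
  block_mx
    (zeta * (1 - rho))%:C%:M (Num.sqrt eta)%:C%:M
    (Num.sqrt eta)%:C%:M     (power + sigma ^+ 2)%:C%:M.

Definition lower_lmi (R : realType) (N : nat)
    (h : 'cV[R[i]]_N) (B W : 'M[R[i]]_N) (mu tund : R) :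
    'M[R[i]]_(N + 1) :=
  block_mx
    (W + mu%:C *: B) (W *m h)
    (h^t* *m W)      (h^t* *m W *m h - tund%:C%:M - mu%:C%:M).

Definition P2_objective (R : realType) (K N : nat)
    (W : 'I_K -> 'M[R[i]]_N) : R[i] :=
  \sum_(i < K) \tr (W i).

Definition P2_feasible (R : realType) (K N : nat)
    (h : 'I_K -> 'I_K -> 'cV[R[i]]_N) (B : 'I_K -> 'I_K -> 'M[R[i]]_N)
    (sigma delta gamma eta zeta : 'I_K -> R)
    (W : 'I_K -> 'M[R[i]]_N) (rho nu : 'I_K -> R)
    (lambda mu tbar tund : 'I_K -> 'I_K -> R) : Prop :=
  [/\ forall i, psd (sinr_lmi (h i i) (B i i) (W i)
                       (rho i) (delta i) (gamma i) (sigma i) (nu i)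
                       (\sum_(j < K | j != i) tbar i j)),
      forall i j, psd (upper_lmi (h i j) (B i j) (W j) (lambda i j) (tbar i j)),
      forall i, psd (energy_lmi (zeta i) (rho i) (eta i) (sigma i)
                       (\sum_(j < K) tund i j)),
      forall i j, psd (lower_lmi (h i j) (B i j) (W j) (mu i j) (tund i j))
    & [/\ forall i j, [/\ 0 <= lambda i j, 0 <= mu i j, 0 <= tbar i j
                        & 0 <= tund i j],
          forall i, 0 <= nu i,
          forall i, 0 <= rho i <= 1,
          forall i, psd (W i)
        & forall i, \rank (W i) = 1%N]].

(* Main.v *)
Require Import Defs.
From mathcomp Require Import all_boot all_order all_algebra.
From mathcomp Require Import reals complex.
From mathcomp Require Import ring lra.
Import Order.TTheory GRing.Theory Num.Theory.
Local Open Scope ring_scope.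
Local Open Scope complex_scope.
Local Open Scope sesquilinear_scope.
Set Implicit Arguments.
Unset Strict Implicit.

(** Since every [W j = w j w_j^H] has rank one, the S-procedure multipliers can
    be written down explicitly.  A robustly feasible [w j] lies in the range of
    every [B i j], even when [B i j] is singular: otherwise some error in the
    kernel of [B i j] violates the first constraint.  With [w = B v],
    [r = sqrt (v^H B v)] and [a = |h^H w|], Cauchy-Schwarz for the form [B]
    shows that the gain [|(h + e)^H w|^2] ranges over
    [[max(0, a - r)^2, (a + r)^2]] on the ellipsoid [e^H B e <= 1].  The maximum
    is certified by [lambda = r (a + r)], the minimum by
    [mu = r max(0, a - r)], and the first LMI holds with [nu = mu / gamma]:
    minimizing it over its first coordinate is a Schur complement producing
    [delta^2 / rho].  Errors of distinct transmitters are independent, so the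
    worst cases can be attained simultaneously. *)

(** * Conjugate transposes, the Hermitian inner product, and range versus kernel *)

Section Dot.
Context {C : numClosedFieldType}.

Lemma trmxC_mul m n p (A : 'M[C]_(m, n)) (B : 'M[C]_(n, p)) :
  (A *m B)^t* = B^t* *m A^t*.
Proof. by rewrite trmx_mul map_mxM. Qed.

Lemma trmxC_add m n (A B : 'M[C]_(m, n)) : (A + B)^t* = A^t* + B^t*.
Proof. by rewrite linearD /= map_mxD. Qed.

Lemma trmxC_scale m n (a : C) (A : 'M[C]_(m, n)) : (a *: A)^t* = a^*%R *: A^t*.
Proof. by rewrite linearZ /= map_mxZ. Qed.

Lemma trmxC_scalar n (a : C) : (a%:M : 'M[C]_n)^t* = (a^*%R)%:M.
Proof. by rewrite tr_scalar_mx map_scalar_mx. Qed.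

Lemma trmxC_block m1 m2 n1 n2 (A : 'M[C]_(m1, n1)) (B : 'M[C]_(m1, n2))
    (D : 'M[C]_(m2, n1)) (E : 'M[C]_(m2, n2)) :
  (block_mx A B D E)^t* = block_mx (A^t*) (D^t*) (B^t*) (E^t*).
Proof. by rewrite tr_block_mx map_block_mx. Qed.

Lemma trmxC_col m1 m2 n (A : 'M[C]_(m1, n)) (B : 'M[C]_(m2, n)) :
  (col_mx A B)^t* = row_mx (A^t*) (B^t*).
Proof. by rewrite tr_col_mx map_row_mx. Qed.

Lemma hermsymmxP n (A : 'M[C]_n) : reflect (A^t* = A) (A \is hermsymmx).
Proof.
by rewrite is_hermitianmxE expr0 scale1r eq_sym; apply: eqP.
Qed.

Definition dot n (x y : 'cV[C]_n) : C := (x^t* *m y) 0 0.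

Lemma mulmx_dot n (x y : 'cV[C]_n) : x^t* *m y = (dot x y)%:M.
Proof. exact: mx11_scalar. Qed.

Lemma dotDl n (x y z : 'cV[C]_n) : dot (x + y) z = dot x z + dot y z.
Proof. by rewrite /dot trmxC_add mulmxDl mxE. Qed.

Lemma dotDr n (x y z : 'cV[C]_n) : dot x (y + z) = dot x y + dot x z.
Proof. by rewrite /dot mulmxDr mxE. Qed.

Lemma dotZl n a (x y : 'cV[C]_n) : dot (a *: x) y = a^*%R * dot x y.
Proof. by rewrite /dot trmxC_scale -scalemxAl mxE. Qed.

Lemma dotZr n a (x y : 'cV[C]_n) : dot x (a *: y) = a * dot x y.
Proof. by rewrite /dot -scalemxAr mxE. Qed.

Lemma conj_dot n (x y : 'cV[C]_n) : (dot x y)^*%R = dot y x.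
Proof.
have -> : dot y x = ((x^t* *m y)^t*) 0 0 by rewrite trmxC_mul trmxCK.
by rewrite [RHS]mxE [X in _ = _ X]mxE.
Qed.

Lemma dot_mulmx n (A : 'M[C]_n) (x y : 'cV[C]_n) :
  A \is hermsymmx -> dot (A *m x) y = dot x (A *m y).
Proof. by move=> /hermsymmxP hA; rewrite /dot trmxC_mul hA mulmxA. Qed.

Lemma dot_eq0 n (x : 'cV[C]_n) : dot x x = 0 -> x = 0.
Proof.
rewrite /dot mxE => /eqP.
rewrite psumr_eq0 => [/allP x0|i _]; last by rewrite !mxE mulrC mul_conjC_ge0.
apply/colP => i; have := x0 i (mem_index_enum i).
by rewrite !mxE mulrC mul_conjC_eq0 => /eqP.
Qed.

(** The range of a Hermitian matrix is the orthogonal complement of its kernel, so a vector outside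
    the range pairs nontrivially with some kernel vector, which can be rescaled to make the pairing
    1. *)
Lemma range_or_kernel n (A : 'M[C]_n) (w : 'cV[C]_n) : A \is hermsymmx ->
  (exists v, w = A *m v) \/ (exists2 e, A *m e = 0 & dot e w = 1).
Proof.
move=> /hermsymmxP hA.
(* Row-space inclusion is the available notion of span, so membership of [w] in the column space of
   [A] is tested on transposes. *)
case: (boolP (w^T <= A^T)%MS) => [/submxP[D wD]|].
  left; exists D^T; apply: trmx_inj.
  by rewrite trmx_mul trmxK.
rewrite submxE => /matrix0Pn[i [j nz]]; right.
pose u := col j (cokermx A^T).
have Au : A^T *m u = 0 by rewrite /u colE mulmxA mulmx_coker mul0mx.
(* For Hermitian [A] the transpose is the entrywise conjugate, so conjugating a vector killed by
   [A^T] gives one killed by [A]. *)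
pose e := map_mx Num.conj u.
have de : dot e w != 0.
  have -> : dot e w = (w^T *m u) 0 0.
    have -> : w^T *m u = (u^T *m w)^T by rewrite trmx_mul trmxK.
    by rewrite /dot /e -map_trmx map_mxCK [RHS]mxE.
  by rewrite /u colE mulmxA -colE mxE -(ord1 i).
exists ((dot e w)^-1^*%R *: e); last first.
  by rewrite dotZl conjCK mulVf.
rewrite -scalemxAr -[X in X *m _]hA -map_mxM.
by rewrite Au map_mx0 scaler0.
Qed.

End Dot.

(** * Real-valued Hermitian forms, rank-one gains and bordered matrices *)

Section Form.
Context {R : realType}.
Local Notation normc := (@Normc.normc R).

Lemma normc_ge0 (z : R[i]) : 0 <= normc z.
Proof. by case: z => a b; exact: sqrtr_ge0. Qed.

Lemma normc2E (z : R[i]) : (normc z ^+ 2)%:C = z * z^*%R.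
Proof. by rewrite -normCK -rmorphXn. Qed.

Lemma normc_real (a : R) : 0 <= a -> normc a%:C = a.
Proof. by move=> a0; rewrite /= expr0n addr0 sqrtr_sqr ger0_norm. Qed.

Lemma normc2_real (a : R) : normc a%:C ^+ 2 = a ^+ 2.
Proof. by apply: complexI; rewrite normc2E !rmorphXn /= conj_Creal ?complex_real. Qed.

Lemma conj_real_complex (a : R) : (a%:C)^*%R = a%:C.
Proof. by rewrite conj_Creal ?complex_real. Qed.

Lemma gainE n (h w : 'cV[R[i]]_n) : (gain h w)%:C = dot h w * dot w h.
Proof. by rewrite -(conj_dot h w) -normc2E. Qed.

Lemma gain_ge0 n (h w : 'cV[R[i]]_n) : 0 <= gain h w.
Proof. exact: sqr_ge0. Qed.

(** Taking the real part puts the value in [R], where it can be compared with gains; nothing is lost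
    for Hermitian [A], by [qformE]. *)
Definition qform n (A : 'M[R[i]]_n) (x : 'cV[R[i]]_n) : R :=
  complex.Re (dot x (A *m x)).

Lemma qformE n (A : 'M[R[i]]_n) (x : 'cV[R[i]]_n) :
  A \is hermsymmx -> (qform A x)%:C = dot x (A *m x).
Proof.
move=> hA; apply/RRe_real/CrealP.
by rewrite conj_dot dot_mulmx.
Qed.

Lemma qform_mx n (A : 'M[R[i]]_n) (x : 'cV[R[i]]_n) :
  A \is hermsymmx -> x^t* *m A *m x = (qform A x)%:C%:M.
Proof. by move=> hA; rewrite qformE // -mulmxA mulmx_dot. Qed.

Lemma qform_ge0 n (A : 'M[R[i]]_n) (x : 'cV[R[i]]_n) : psd A -> 0 <= qform A x.
Proof.
case=> hA /(_ x); rewrite qform_mx // mxE eqxx mulr1n; by rewrite ler0c.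
Qed.

Lemma psdP n (A : 'M[R[i]]_n) : A \is hermsymmx ->
  psd A <-> forall x, 0 <= qform A x.
Proof.
move=> hA; split=> [pA x|pA]; first exact: qform_ge0.
by split=> // x; rewrite qform_mx // mxE eqxx mulr1n ler0c.
Qed.

Lemma hermsymmx_rank1 n (w : 'cV[R[i]]_n) : w *m w^t* \is hermsymmx.
Proof. by apply/hermsymmxP; rewrite trmxC_mul trmxCK. Qed.

Lemma gram_mxE n (w h : 'cV[R[i]]_n) :
  h^t* *m (w *m w^t*) *m h = (gain h w)%:C%:M.
Proof.
by rewrite gainE !mulmxA mulmx_dot -mulmxA mulmx_dot -scalar_mxM.
Qed.

Lemma hermsymmxD n (A B : 'M[R[i]]_n) :
  A \is hermsymmx -> B \is hermsymmx -> A + B \is hermsymmx.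
Proof.
by move=> /hermsymmxP hA /hermsymmxP hB; apply/hermsymmxP; rewrite trmxC_add hA hB.
Qed.

Lemma hermsymmxZ n (a : R) (A : 'M[R[i]]_n) :
  A \is hermsymmx -> a%:C *: A \is hermsymmx.
Proof.
by move=> /hermsymmxP hA; apply/hermsymmxP; rewrite trmxC_scale hA conj_real_complex.
Qed.

Lemma hermsymmxN n (A : 'M[R[i]]_n) : A \is hermsymmx -> - A \is hermsymmx.
Proof. by rewrite -scaleN1r => /(hermsymmxZ (-1)); rewrite rmorphN1. Qed.

Lemma hermsymmx_real n (a : R) : (a%:C%:M : 'M[R[i]]_n) \is hermsymmx.
Proof. by apply/hermsymmxP; rewrite trmxC_scalar conj_real_complex. Qed.

Lemma hermsymmx_block m n (A : 'M[R[i]]_m) (b : 'M[R[i]]_(m, n)) c (D : 'M[R[i]]_n) :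
  A \is hermsymmx -> D \is hermsymmx -> b^t* = c -> block_mx A b c D \is hermsymmx.
Proof.
move=> /hermsymmxP hA /hermsymmxP hD <-; apply/hermsymmxP.
by rewrite trmxC_block hA hD trmxCK.
Qed.

Lemma mulmx_cV_scalar n (b : 'cV[R[i]]_n) s : b *m s%:M = s *: b.
Proof. exact: mul_mx_scalar. Qed.

Lemma Re_double (z : R[i]) : (2 * complex.Re z)%:C = z + z^*%R.
Proof. by rewrite (addcJ z) rmorphM rmorph_nat. Qed.

Lemma qform_dotE n (A : 'M[R[i]]_n) x : qform A x = complex.Re ((x^t* *m A *m x) 0 0).
Proof. by rewrite /qform /dot mulmxA. Qed.

(** The two off-diagonal blocks contribute conjugate terms, which add up to twice a real part. *)
Lemma border_terms n (A : 'M[R[i]]_n) (b x : 'cV[R[i]]_n) (d : R) (s : R[i]) : A \is hermsymmx ->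
  complex.Re (dot x (A *m x) + s * dot x b + (s^*%R * dot b x + s^*%R * d%:C * s)) =
  qform A x + 2 * complex.Re (s * dot x b) + d * normc s ^+ 2.
Proof.
move=> hA; apply: complexI; rewrite RRe_real.
  rewrite !rmorphD (rmorphM _ d) /= -qformE // normc2E Re_double rmorphM /= conj_dot.
  by rewrite /=; ring.
apply/CrealP; rewrite !rmorphD !rmorphM /= !conj_dot conjCK conj_real_complex dot_mulmx //.
ring.
Qed.

Lemma qform_border_r n (A : 'M[R[i]]_n) (b x : 'cV[R[i]]_n) (d : R) (s : R[i]) : A \is hermsymmx ->
  qform (block_mx A b (b^t*) d%:C%:M) (col_mx x s%:M) =
  qform A x + 2 * complex.Re (s * dot x b) + d * normc s ^+ 2.
Proof.
move=> hA; rewrite -border_terms // qform_dotE trmxC_col mul_row_block mul_row_col.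
rewrite trmxC_scalar !mulmxDl !mulmx_cV_scalar; congr complex.Re.
rewrite !mul_scalar_mx -!scalemxAl !mulmx_dot -(mulmxA _ A x).
rewrite (mulmx_dot x (A *m x)) !scale_scalar_mx -!raddfD. rewrite mxE eqxx mulr1n.
ring.
Qed.

Lemma qform_border_l n (A : 'M[R[i]]_n) (b x : 'cV[R[i]]_n) (d : R) (s : R[i]) : A \is hermsymmx ->
  qform (block_mx d%:C%:M (b^t*) b A) (col_mx s%:M x) =
  qform A x + 2 * complex.Re (s * dot x b) + d * normc s ^+ 2.
Proof.
move=> hA; rewrite -border_terms // qform_dotE trmxC_col mul_row_block mul_row_col.
rewrite trmxC_scalar !mulmxDl !mulmx_cV_scalar; congr complex.Re.
rewrite !mul_scalar_mx -!scalemxAl !mulmx_dot -(mulmxA _ A x).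
rewrite (mulmx_dot x (A *m x)) !scale_scalar_mx -!raddfD. rewrite mxE eqxx mulr1n.
ring.
Qed.
(** The right-hand side has the shape of a bordered form with corner [gain h w], which lets each LMI
    be read as an inequality on the gain of the homogenized channel [x + s *: h]. *)
Lemma gain_shift n (h w x : 'cV[R[i]]_n) s :
  gain (x + s *: h) w =
  gain x w + 2 * complex.Re (s * dot x (w *m w^t* *m h)) + normc s ^+ 2 * gain h w.
Proof.
have -> : dot x (w *m w^t* *m h) = dot x w * dot w h.
  by rewrite -mulmxA mulmx_dot mul_mx_scalar dotZr mulrC.
apply: complexI; rewrite !rmorphD (rmorphM _ (_ ^+ 2)) /= !gainE normc2E Re_double.
rewrite !rmorphM /= !conj_dot !(dotDl, dotDr, dotZl, dotZr).
ring.
Qed.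

Lemma qform_rank1 n (w x : 'cV[R[i]]_n) : qform (w *m w^t*) x = gain x w.
Proof.
apply: complexI; rewrite qformE ?hermsymmx_rank1 // gainE.
by rewrite -mulmxA mulmx_dot mul_mx_scalar dotZr mulrC.
Qed.

Lemma qformD n (A B : 'M[R[i]]_n) x : qform (A + B) x = qform A x + qform B x.
Proof. by rewrite /qform mulmxDl dotDr raddfD. Qed.

Lemma qformZ n a (A : 'M[R[i]]_n) x : A \is hermsymmx ->
  qform (a%:C *: A) x = a * qform A x.
Proof.
move=> hA; apply: complexI; rewrite qformE ?hermsymmxZ // rmorphM /= qformE //.
by rewrite -scalemxAl dotZr.
Qed.

Lemma psd_border_r n (A : 'M[R[i]]_n) b (d : R) : A \is hermsymmx ->
  psd (block_mx A b (b^t*) d%:C%:M) <->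
  forall x s, 0 <= qform A x + 2 * complex.Re (s * dot x b) + d * normc s ^+ 2.
Proof.
move=> hA.
have hM : block_mx A b (b^t*) d%:C%:M \is hermsymmx.
  by apply: hermsymmx_block => //; exact: hermsymmx_real.
rewrite psdP //; split=> [q0 x s|f0 x]; first by rewrite -qform_border_r.
by rewrite -(vsubmxK x) [dsubmx x]mx11_scalar qform_border_r.
Qed.

Lemma psd_border_l n (A : 'M[R[i]]_n) b (d : R) : A \is hermsymmx ->
  psd (block_mx d%:C%:M (b^t*) b A) <->
  forall x s, 0 <= qform A x + 2 * complex.Re (s * dot x b) + d * normc s ^+ 2.
Proof.
move=> hA.
have hM : block_mx d%:C%:M (b^t*) b A \is hermsymmx.
  by apply: hermsymmx_block; rewrite ?trmxCK //; exact: hermsymmx_real.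
rewrite psdP //; split=> [q0 x s|f0 x]; first by rewrite -qform_border_l.
by rewrite -(vsubmxK x) [usubmx x]mx11_scalar qform_border_l.
Qed.

Lemma gram_border n (w h : 'cV[R[i]]_n) : h^t* *m (w *m w^t*) = (w *m w^t* *m h)^t*.
Proof. by rewrite !trmxC_mul trmxCK. Qed.

End Form.

(** * The four LMIs as scalar inequalities *)

Section LMI.
Context {R : realType}.
Local Notation normc := (@Normc.normc R).

(** This is the homogenized S-procedure certificate: at [s = 1] it bounds the gain below by
    [t + mu * (1 - qform B x)], hence by [t] on the ellipsoid when [mu] is nonnegative. *)
Lemma lower_lmiP n (h w : 'cV[R[i]]_n) B (mu t : R) : B \is hermsymmx ->
  psd (lower_lmi h B (w *m w^t*) mu t) <->
  forall x s, (t + mu) * normc s ^+ 2 <= gain (x + s *: h) w + mu * qform B x.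
Proof.
move=> hB; rewrite /lower_lmi gram_mxE gram_border -!raddfB /=.
rewrite psd_border_r ?hermsymmxD ?hermsymmxZ ?hermsymmx_rank1 //.
suff E x s : qform (w *m w^t* + mu%:C *: B) x
    + 2 * complex.Re (s * dot x (w *m w^t* *m h)) + (gain h w - t - mu) * normc s ^+ 2
    = gain (x + s *: h) w + mu * qform B x - (t + mu) * normc s ^+ 2.
  by split=> H x s; have := H x s; rewrite E subr_ge0.
rewrite gain_shift qformD qformZ // qform_rank1; ring.
Qed.

Lemma upper_lmiP n (h w : 'cV[R[i]]_n) B (lam t : R) : B \is hermsymmx ->
  psd (upper_lmi h B (w *m w^t*) lam t) <->
  forall x s, gain (x + s *: h) w <= lam * qform B x + (t - lam) * normc s ^+ 2.
Proof.
move=> hB; rewrite /upper_lmi gram_mxE gram_border -!raddfB /=.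
have -> : - (w *m w^t* *m h)^t* = (- (w *m w^t* *m h))^t*.
  by rewrite raddfN /= map_mxN.
rewrite psd_border_r ?hermsymmxD ?hermsymmxN ?hermsymmxZ ?hermsymmx_rank1 //.
suff E x s : qform (- (w *m w^t*) + lam%:C *: B) x
    + 2 * complex.Re (s * dot x (- (w *m w^t* *m h)))
    + (t - gain h w - lam) * normc s ^+ 2
    = lam * qform B x + (t - lam) * normc s ^+ 2 - gain (x + s *: h) w.
  by split=> H x s; have := H x s; rewrite E subr_ge0.
have qN A : qform (- A) x = - qform A x.
  by rewrite /qform mulNmx /dot mulmxN mxE raddfN.
have dN (a : 'cV[R[i]]_n) : dot x (- a) = - dot x a by rewrite /dot mulmxN mxE.
rewrite gain_shift qformD qformZ // qN qform_rank1 dN mulrN raddfN /=.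
ring.
Qed.

Lemma energy_lmiP (zeta rho eta sigma power : R) :
  psd (energy_lmi zeta rho eta sigma power) <->
  forall a b : R[i], 0 <= zeta * (1 - rho) * normc a ^+ 2 +
    2 * complex.Re (b * (a^*%R * (Num.sqrt eta)%:C)) + (power + sigma ^+ 2) * normc b ^+ 2.
Proof.
rewrite /energy_lmi -[X in block_mx _ _ X](_ : ((Num.sqrt eta)%:C%:M)^t* = _); last first.
  by rewrite trmxC_scalar conj_real_complex.
rewrite psd_border_r ?hermsymmx_real //.
have E (a : R[i]) : qform (zeta * (1 - rho))%:C%:M (a%:M : 'cV_1) = zeta * (1 - rho) * normc a ^+ 2.
  apply: complexI; rewrite qformE ?hermsymmx_real // [RHS]rmorphM /= normc2E.
  by rewrite /dot trmxC_scalar -!scalar_mxM mxE eqxx mulr1n; ring.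
have E2 (a c : R[i]) : dot (a%:M : 'cV_1) c%:M = a^*%R * c.
  by rewrite /dot trmxC_scalar -!scalar_mxM mxE eqxx mulr1n.
split=> [H a b|H x s]; first by have := H a%:M b; rewrite E E2.
by rewrite (mx11_scalar x) E E2.
Qed.

(** Here [p] is the coordinate of the [rho] row, [s] that of the middle row and [x] that of the last
    block; keeping [p] apart prepares its elimination by a Schur complement. *)
Lemma sinr_lmiP n (h w : 'cV[R[i]]_n) B (rho delta gamma sigma nu interf : R) :
  B \is hermsymmx ->
  psd (sinr_lmi h B (w *m w^t*) rho delta gamma sigma nu interf) <->
  forall x s p, 0 <= gamma^-1 * gain (x + s *: h) w + nu * qform B x
    - (interf + sigma ^+ 2 + nu) * normc s ^+ 2
    + 2 * delta * complex.Re (p * s^*%R) + rho * normc p ^+ 2.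
Proof.
move=> hB; rewrite /sinr_lmi gram_mxE gram_border.
set b := w *m w^t* *m h; set g := gamma^-1.
have -> : row_mx delta%:C%:M 0 = (col_mx (delta%:C%:M : 'cV[R[i]]_1) (0 : 'cV_n))^t*.
  by rewrite trmxC_col trmxC_scalar conj_real_complex trmx0 map_mx0.
have -> : g%:C *: b^t* = (g%:C *: b)^t* by rewrite trmxC_scale conj_real_complex.
rewrite scale_scalar_mx -rmorphM -raddfB -rmorphB.
have hD : g%:C *: (w *m w^t*) + nu%:C *: B \is hermsymmx.
  by rewrite hermsymmxD ?hermsymmxZ ?hermsymmx_rank1.
rewrite psd_border_l; last first.
  by apply: hermsymmx_block; rewrite ?trmxCK ?hermsymmx_real.
have E x s p : qform (block_mx (g * gain h w - (interf + sigma ^+ 2 + nu))%:C%:M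
      ((g%:C *: b)^t*) (g%:C *: b) (g%:C *: (w *m w^t*) + nu%:C *: B)) (col_mx s%:M x)
    + 2 * complex.Re (p * dot (col_mx s%:M x) (col_mx delta%:C%:M 0)) + rho * normc p ^+ 2
    = g * gain (x + s *: h) w + nu * qform B x
    - (interf + sigma ^+ 2 + nu) * normc s ^+ 2
    + 2 * delta * complex.Re (p * s^*%R) + rho * normc p ^+ 2.
  rewrite qform_border_l // gain_shift qformD !qformZ ?hermsymmx_rank1 // qform_rank1.
  have -> : dot (col_mx s%:M x) (col_mx delta%:C%:M 0) = delta%:C * s^*%R.
    rewrite /dot trmxC_col mul_row_col mulmx0 addr0 trmxC_scalar -scalar_mxM.
    by rewrite mxE eqxx mulr1n mulrC.
  have ReZ (a : R) z : complex.Re (a%:C * z) = a * complex.Re z.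
    by case: z => u v /=; rewrite mul0r subr0.
  by rewrite dotZr (mulrCA s) (mulrCA p) !ReZ; ring.
split=> [H x s p|H x p]; first by rewrite -E.
by rewrite -(vsubmxK x) [usubmx x]mx11_scalar E.
Qed.
End LMI.

(** * Cauchy-Schwarz for a semidefinite form and the scalar certificates *)

Section Certificates.
Context {R : realType}.
Local Notation normc := (@Normc.normc R).

Lemma Re_ge_normc (z : R[i]) : - normc z <= complex.Re z.
Proof.
rewrite lerNl; apply: le_trans (ler_norm _) _; rewrite normrN.
by case: z => a b /=; rewrite -sqrtr_sqr ler_wsqrtr // lerDl sqr_ge0.
Qed.

Lemma normc_conj (z : R[i]) : normc z^*%R = normc z.
Proof. by case: z => a b /=; rewrite sqrrN. Qed.

Lemma normc_triangle (y z : R[i]) : normc (y + z) <= normc y + normc z.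
Proof. exact: le_normcD. Qed.

Lemma normc_triangle_sub (y z : R[i]) : normc y - normc z <= normc (y + z).
Proof.
rewrite lerBlDr; have := normc_triangle (y + z) (- z).
by rewrite addrK normcN.
Qed.

Lemma qform_shift n (B : 'M[R[i]]_n) (x v : 'cV[R[i]]_n) (c : R[i]) : B \is hermsymmx ->
  qform B (x + c *: v) =
  qform B x + 2 * complex.Re (c * dot x (B *m v)) + normc c ^+ 2 * qform B v.
Proof.
move=> hB; apply: complexI.
rewrite qformE // !rmorphD (rmorphM _ (_ ^+ 2)) /= normc2E Re_double !qformE //.
rewrite rmorphM /= conj_dot dot_mulmx // mulmxDr -scalemxAr.
rewrite !(dotDl, dotDr, dotZl, dotZr); ring.
Qed.

Lemma qformZv n (B : 'M[R[i]]_n) (v : 'cV[R[i]]_n) (c : R[i]) : B \is hermsymmx ->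
  qform B (c *: v) = normc c ^+ 2 * qform B v.
Proof.
move=> hB; have := qform_shift 0 v c hB.
have d0 y : dot (0 : 'cV[R[i]]_n) y = 0 by rewrite /dot trmx0 map_mx0 mul0mx mxE.
by rewrite add0r /qform !d0 mulr0 /= mulr0 !add0r.
Qed.

(** For positive [c] the value [t = c^-1] minimizes the quadratic; for [c = 0] it is affine in [t],
    so a nonzero slope would make it negative somewhere. The factor [b] in both terms avoids
    dividing by [b]. *)
Lemma le_of_quadratic (a b c : R) : 0 <= b -> 0 <= c ->
  (forall t, 0 <= a - 2 * t * b + t ^+ 2 * b * c) -> b <= c * a.
Proof.
move=> b0; rewrite le_eqVlt => /predU1P[<-|c0] H.
  rewrite mul0r; case: (ltP 0 b) => // bp.
  have := H ((a + 1) / (2 * b)).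
  have -> : a - 2 * ((a + 1) / (2 * b)) * b
      + ((a + 1) / (2 * b)) ^+ 2 * b * 0 = - 1 by field; rewrite gt_eqF.
  by rewrite oppr_ge0 ler10.
have := H c^-1.
have -> : a - 2 * c^-1 * b + c^-1 ^+ 2 * b * c = c^-1 * (c * a - b).
  by field; rewrite gt_eqF.
by rewrite pmulr_rge0 ?invr_gt0 // subr_ge0.
Qed.

Lemma psd_CauchySchwarz n (B : 'M[R[i]]_n) (x v : 'cV[R[i]]_n) : psd B ->
  gain x (B *m v) <= qform B v * qform B x.
Proof.
move=> pB; have hB := proj1 pB.
apply: le_of_quadratic; rewrite ?gain_ge0 ?qform_ge0 // => t.
pose k := dot v (B *m x).
have kE : dot x (B *m v) = k^*%R by rewrite conj_dot dot_mulmx.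
have nk : normc k ^+ 2 = gain x (B *m v) by rewrite /gain -/(dot _ _) kE normc_conj.
(* Multiplying [t] by [k] aligns the phases, so the cross term becomes the real number
   [- 2 * t * gain x (B *m v)]. *)
have := qform_ge0 (x + ((- t)%:C * k) *: v) pB.
rewrite qform_shift // Normc.normcM exprMn normc2_real nk kE -mulrA -normc2E nk.
by rewrite -rmorphM /=; congr (_ <= _); ring.
Qed.

(** Cauchy-Schwarz with [x = B *m v] shows that [qform B v = 0] would force [B *m v] to have zero
    norm. *)
Lemma qform_gt0 n (B : 'M[R[i]]_n) (v : 'cV[R[i]]_n) : psd B ->
  B *m v != 0 -> 0 < qform B v.
Proof.
move=> pB nz; rewrite lt_def qform_ge0 // andbT.
apply: contra_neq nz => qv0; apply: dot_eq0.
have := psd_CauchySchwarz (B *m v) v pB; rewrite qv0 mul0r => le0.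
apply: Normc.eq0_normc; apply/eqP; rewrite -sqrf_eq0.
by rewrite eq_le le0 sqr_ge0.
Qed.

(** Multiplied by [r], the gap between the bound and [(y + n * a) ^+ 2] is exactly [(a + r) * (r ^+
    2 * q - y ^+ 2) + a * (y - r * n) ^+ 2]. *)
Lemma upper_certificate (r a q n y g : R) : 0 < r -> 0 <= a -> 0 <= g ->
  y ^+ 2 <= r ^+ 2 * q -> g <= y + n * a ->
  g ^+ 2 <= r * (a + r) * q + ((a + r) ^+ 2 - r * (a + r)) * n ^+ 2.
Proof.
move=> r0 a0 g0 yq gy.
have g2 : g ^+ 2 <= (y + n * a) ^+ 2 by rewrite ler_sqr ?nnegrE // (le_trans g0).
have H1 : 0 <= (a + r) * (r ^+ 2 * q - y ^+ 2).
  by rewrite mulr_ge0 ?subr_ge0 // addr_ge0 // ltW.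
have H2 : 0 <= a * (y - r * n) ^+ 2 by rewrite mulr_ge0 ?sqr_ge0.
rewrite (le_trans g2) // -(ler_pM2l r0) -subr_ge0.
apply: le_trans (addr_ge0 H1 H2) _; rewrite le_eqVlt; apply/orP; left.
by apply/eqP; ring.
Qed.

(** The same device, with [m] standing for [a - r]: the scaled gap is [m * (r ^+ 2 * q - y ^+ 2) +
    (r + m) * (y - r * n) ^+ 2]. *)
Lemma lower_certificate (r m q n y g : R) : 0 < r -> 0 <= m ->
  y ^+ 2 <= r ^+ 2 * q -> (y - n * (r + m)) ^+ 2 <= g ^+ 2 ->
  (m ^+ 2 + r * m) * n ^+ 2 <= g ^+ 2 + r * m * q.
Proof.
move=> r0 m0 yq gy.
have H1 : 0 <= m * (r ^+ 2 * q - y ^+ 2) by rewrite mulr_ge0 ?subr_ge0.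
have H2 : 0 <= (r + m) * (y - r * n) ^+ 2.
  by rewrite mulr_ge0 ?sqr_ge0 // addr_ge0 // ltW.
apply: le_trans (_ : _ <= (y - n * (r + m)) ^+ 2 + r * m * q) _; last by rewrite lerD2r.
rewrite -(ler_pM2l r0) -subr_ge0.
apply: le_trans (addr_ge0 H1 H2) _; rewrite le_eqVlt; apply/orP; left.
by apply/eqP; ring.
Qed.

(** * Extreme gains over one ellipsoid, with matching multipliers *)

Section Extremes.
Variables (n : nat) (B : 'M[R[i]]_n) (h v w : 'cV[R[i]]_n).
Hypotheses (pB : psd B) (wE : w = B *m v) (w0 : w != 0).
Let hB := proj1 pB.
Let a := normc (dot h w).
Let r := Num.sqrt (qform B v).

Let qv : qform B v = r ^+ 2.
Proof. by rewrite sqr_sqrtr ?qform_ge0. Qed.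

Let r0 : 0 < r.
Proof. by rewrite sqrtr_gt0 qform_gt0 // -wE. Qed.

Let a0 : 0 <= a. Proof. exact: normc_ge0. Qed.

Lemma gain_attained (g : R) : 0 <= g -> `|g - a| <= r ->
  exists2 e, qform B e <= 1 & gain (h + e) w = g ^+ 2.
Proof.
move=> g0 gr.
(* Errors along [v] suffice: since [v^H w = r ^+ 2], the multiple of [v] by the conjugate of
   [z / r ^+ 2] adds exactly [z] to [h^H w], and it lies in the ellipsoid as soon as [z] has modulus
   at most [r]. *)
suff [z zr zg] : exists2 z : R[i], normc z <= r & normc (dot h w + z) = g.
  exists ((z * (r ^- 2)%:C)^*%R *: v).
    rewrite qformZv // normc_conj Normc.normcM exprMn normc2_real qv.
    have -> : normc z ^+ 2 * (r ^- 2) ^+ 2 * r ^+ 2 = (normc z / r) ^+ 2.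
      by field; rewrite gt_eqF.
    by rewrite exprn_ile1 ?divr_ge0 ?normc_ge0 ?ler_pdivrMr ?mul1r // ltW.
  rewrite /gain -/(dot _ _) dotDl dotZl conjCK {2}wE -qformE // qv -mulrA -rmorphM.
  by rewrite mulVf ?mulr1 ?zg // sqrf_eq0 gt_eqF.
(* The shift [z] should have the phase of [h^H w]; when that number vanishes there is no phase and
   any direction works. *)
have [a_0|an0] := eqVneq a 0.
  exists g%:C; first by rewrite normc_real // (le_trans (ler_norm _)) // -[g]subr0 -a_0.
  by rewrite (Normc.eq0_normc a_0) add0r normc_real.
have ap : 0 < a by rewrite lt_def an0.
have nR (t : R) : normc t%:C = `|t| by rewrite /= expr0n addr0 sqrtr_sqr.
exists (dot h w * ((g - a) / a)%:C).
  by rewrite Normc.normcM nR normrM normfV -/a (gtr0_norm ap) mulrC divfK.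
have -> : dot h w + dot h w * ((g - a) / a)%:C = dot h w * (g / a)%:C.
  rewrite -{1}[dot h w]mulr1 -mulrDr -(rmorph1 (real_complex R)) -rmorphD.
  by congr (_ * _%:C); field.
by rewrite Normc.normcM nR -/a ger0_norm ?divr_ge0 // mulrC divfK.
Qed.

Let gain_dot x s : gain (x + s *: h) w = normc (dot x w + s^*%R * dot h w) ^+ 2.
Proof. by rewrite /gain -/(dot _ _) dotDl dotZl. Qed.

Let dot_bound x : normc (dot x w) ^+ 2 <= r ^+ 2 * qform B x.
Proof. by rewrite -qv {1}wE; exact: psd_CauchySchwarz. Qed.

Let norm_sh s : normc (s^*%R * dot h w) = normc s * a.
Proof. by rewrite Normc.normcM normc_conj. Qed.

(** The pair is ([lambda], [tbar]). Attainment makes [tbar] the exact worst case, so replacing gains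
    by it loses nothing. *)
Lemma max_gain_dual : exists lt : R * R, [/\ 0 <= lt.1, 0 <= lt.2,
  psd (upper_lmi h B (w *m w^t*) lt.1 lt.2) &
  exists2 e, qform B e <= 1 & gain (h + e) w = lt.2].
Proof.
have ar : 0 <= a + r by rewrite addr_ge0 // ltW.
exists (r * (a + r), (a + r) ^+ 2); split=> /=.
- by rewrite mulr_ge0 // ltW.
- exact: sqr_ge0.
- apply/upper_lmiP=> // x s; rewrite gain_dot.
  apply: (upper_certificate _ _ _ (dot_bound x)) => //; first exact: normc_ge0.
  by rewrite -norm_sh normc_triangle.
- by apply: gain_attained; rewrite // addrAC subrr add0r gtr0_norm.
Qed.

(** The pair is ([mu], [tund]). The certificate is kept as a scalar inequality because it serves
    both the lower LMI and the SINR LMI. *)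
Lemma min_gain_dual : exists mt : R * R, [/\ 0 <= mt.1, 0 <= mt.2,
  forall x s, (mt.2 + mt.1) * normc s ^+ 2 <= gain (x + s *: h) w + mt.1 * qform B x &
  exists2 e, qform B e <= 1 & gain (h + e) w = mt.2].
Proof.
(* If [a < r], an admissible error cancels the signal completely, so the minimum is 0 and the zero
   multiplier certifies it. *)
have [ra|ar] := leP r a; last first.
  exists (0, 0); split=> //= [x s|].
    by rewrite !(addr0, mul0r) gain_ge0.
  have := gain_attained (lexx 0); rewrite expr0n; apply.
  by rewrite sub0r normrN ger0_norm // ltW.
have m0 : 0 <= a - r by rewrite subr_ge0.
exists (r * (a - r), (a - r) ^+ 2); split=> /=.
- by rewrite mulr_ge0 // ltW.
- exact: sqr_ge0.
- move=> x s; rewrite gain_dot.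
  apply: (lower_certificate _ _ (dot_bound x)) => //.
  (* As [r + (a - r) = a], the hypothesis on squares is the reverse triangle inequality, used in
     both directions. *)
  rewrite subrKC -norm_sh -[leLHS]real_normK ?num_real // ler_sqr ?nnegrE ?normc_ge0 //.
  rewrite ler_norml normc_triangle_sub andbT lerNl opprB.
  by rewrite [dot x w + _]addrC normc_triangle_sub.
- by apply: gain_attained; rewrite // addrAC subrr add0r normrN gtr0_norm.
Qed.

End Extremes.

(** Moving along the kernel of [B] costs nothing in the ellipsoid constraint, so the channel
    response can be set to any [z]. *)
Lemma gain_kernel n (B : 'M[R[i]]_n) (h e0 w : 'cV[R[i]]_n) (z : R[i]) :
  B *m e0 = 0 -> dot e0 w = 1 -> exists2 e, qform B e <= 1 & dot (h + e) w = z.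
Proof.
move=> Be0 de0; exists ((z - dot h w)^*%R *: e0).
  by rewrite /qform -scalemxAr Be0 scaler0 /dot mulmx0 mxE ler01.
by rewrite dotDl dotZl conjCK de0 mulr1 addrC subrK.
Qed.
End Certificates.

(** * From LMIs to robust constraints and back, one receiver at a time *)

Section Constraints.
Context {R : realType}.
Local Notation normc := (@Normc.normc R).

Lemma lower_bound n (h w e : 'cV[R[i]]_n) B (mu t : R) : B \is hermsymmx ->
  psd (lower_lmi h B (w *m w^t*) mu t) -> 0 <= mu -> qform B e <= 1 ->
  t <= gain (h + e) w.
Proof.
move=> hB /lower_lmiP-/(_ hB e 1); rewrite Normc.normc1 expr1n mulr1 scale1r [e + h]addrC => H mu0 e1.
by rewrite -(lerD2r mu) (le_trans H) // lerD2l ler_piMr.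
Qed.

Lemma upper_bound n (h w e : 'cV[R[i]]_n) B (lam t : R) : B \is hermsymmx ->
  psd (upper_lmi h B (w *m w^t*) lam t) -> 0 <= lam -> qform B e <= 1 ->
  gain (h + e) w <= t.
Proof.
move=> hB /upper_lmiP-/(_ hB e 1); rewrite Normc.normc1 expr1n mulr1 scale1r [e + h]addrC => H lam0 e1.
rewrite (le_trans H) // addrCA gerDl subr_le0.
by rewrite ler_piMr.
Qed.

Lemma sinr_lmi_of_min n (h w : 'cV[R[i]]_n) B (rho delta gamma sigma mu t interf : R) :
  B \is hermsymmx -> 0 < gamma -> 0 < delta -> 0 < rho ->
  (forall x s, (t + mu) * normc s ^+ 2 <= gain (x + s *: h) w + mu * qform B x) ->
  gamma * (interf + sigma ^+ 2 + delta ^+ 2 / rho) <= t ->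
  psd (sinr_lmi h B (w *m w^t*) rho delta gamma sigma (mu / gamma) interf).
Proof.
move=> hB g0 d0 r0 H tg; apply/sinr_lmiP => // x s p.
set D := interf + sigma ^+ 2 in tg *.
have Rp : 0 <= 2 * delta * (complex.Re (p * s^*%R) + normc p * normc s).
  rewrite mulr_ge0 ?mulr_ge0 ?(ltW d0) // -lerBlDr sub0r.
  by rewrite -[normc s]normc_conj -Normc.normcM Re_ge_normc.
have sq : 0 <= (rho * normc p - delta * normc s) ^+ 2 / rho.
  by rewrite divr_ge0 ?sqr_ge0 // ltW.
have Hs := H x s.
have gi0 : 0 < gamma^-1 by rewrite invr_gt0.
have H1 : 0 <= gamma^-1 * (gain (x + s *: h) w + mu * qform B x - (t + mu) * normc s ^+ 2).
  by rewrite pmulr_rge0 // subr_ge0.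
have H2 : 0 <= gamma^-1 * (t - gamma * (D + delta ^+ 2 / rho)) * normc s ^+ 2.
  by rewrite mulr_ge0 ?sqr_ge0 // pmulr_rge0 // subr_ge0.
apply: le_trans (addr_ge0 (addr_ge0 H1 H2) (addr_ge0 Rp sq)) _.
rewrite le_eqVlt; apply/orP; left; apply/eqP; field.
by rewrite !gt_eqF.
Qed.

Lemma sinr_bound n (h w e : 'cV[R[i]]_n) B (rho delta gamma sigma nu interf : R) :
  B \is hermsymmx -> 0 < gamma -> 0 < delta -> 0 <= rho -> 0 <= nu ->
  psd (sinr_lmi h B (w *m w^t*) rho delta gamma sigma nu interf) ->
  qform B e <= 1 ->
  0 < rho /\ gamma * (interf + sigma ^+ 2 + delta ^+ 2 / rho) <= gain (h + e) w.
Proof.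
move=> hB g0 d0 r0 nu0 /sinr_lmiP-/(_ hB e 1) H e1.
have {}H (t : R) : 0 <= gamma^-1 * gain (h + e) w - (interf + sigma ^+ 2)
    + 2 * delta * t + rho * t ^+ 2.
  have := H t%:C; rewrite Normc.normc1 expr1n mulr1 scale1r rmorph1 mulr1 normc2_real /=.
  rewrite [e + h]addrC => Ht; apply: le_trans Ht _.
  have e2 : 0 <= nu * (1 - qform B e) by rewrite mulr_ge0 // subr_ge0.
  rewrite -subr_ge0; apply: le_trans e2 _; rewrite le_eqVlt; apply/orP; left.
  by apply/eqP; ring.
set G := gain _ _ in H *; set D := interf + sigma ^+ 2 in H *.
(* At [rho = 0] the bound would be affine in [t] with slope [2 * delta], and the chosen [t] makes it
   -1. *)
have rho0 : 0 < rho.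
  rewrite lt_def r0 andbT; apply/eqP => rho0.
  set X := gamma^-1 * G - D in H.
  have := H (- (X + 1) / (2 * delta)); rewrite rho0.
  have -> : X + 2 * delta * (- (X + 1) / (2 * delta)) + 0 * (- (X + 1) / (2 * delta)) ^+ 2 = -1.
    by field; rewrite gt_eqF.
  by rewrite oppr_ge0 ler10.
split=> //.
(* This [t] minimizes the quadratic; its minimum produces the term [delta ^+ 2 / rho]. *)
have := H (- (delta / rho)).
have -> : gamma^-1 * G - D + 2 * delta * - (delta / rho) + rho * (- (delta / rho)) ^+ 2
  = gamma^-1 * (G - gamma * (D + delta ^+ 2 / rho)) by field; rewrite !gt_eqF.
by rewrite pmulr_rge0 ?invr_gt0 // subr_ge0.
Qed.

(** As the lower-right entry is positive, semidefiniteness reduces to nonnegativity of the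
    determinant, [eta] being the square of the off-diagonal entry. *)
Lemma energy_psd (zeta rho eta sigma power : R) :
  0 < eta -> 0 < power + sigma ^+ 2 ->
  psd (energy_lmi zeta rho eta sigma power) <->
  eta <= zeta * (1 - rho) * (power + sigma ^+ 2).
Proof.
move=> eta0; rewrite energy_lmiP; set A := zeta * _; set P := power + _ => P0.
have sE : Num.sqrt eta ^+ 2 = eta by rewrite sqr_sqrtr ?ltW.
set c := Num.sqrt eta in sE *.
have c0 : 0 <= c by exact: sqrtr_ge0.
split=> [H|H a b].
  (* On the vector [(P, - c)] the form equals [P] times the determinant. *)
  have := H P%:C (- c)%:C.
  rewrite conj_real_complex -!rmorphM /= !normc2_real.
  have -> : A * P ^+ 2 + 2 * (- c * (P * c)) + P * (- c) ^+ 2 = P * (A * P - eta).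
    by rewrite -sE; ring.
  by rewrite pmulr_rge0 // subr_ge0.
have Rp : 0 <= 2 * (complex.Re (b * (a^*%R * c%:C)) + normc b * (normc a * c)).
  rewrite mulr_ge0 // -lerBlDr sub0r.
  have := Re_ge_normc (b * (a^*%R * c%:C)).
  by rewrite !Normc.normcM normc_conj normc_real.
have sq : 0 <= (P * normc b - c * normc a) ^+ 2 / P.
  by rewrite divr_ge0 ?sqr_ge0 // ltW.
have H2 : 0 <= (A * P - eta) / P * normc a ^+ 2.
  by rewrite mulr_ge0 ?sqr_ge0 // divr_ge0 ?subr_ge0 // ltW.
apply: le_trans (addr_ge0 (addr_ge0 Rp sq) H2) _.
rewrite le_eqVlt; apply/orP; left; apply/eqP; rewrite -sE; field.
by rewrite !gt_eqF.
Qed.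

Lemma rank1_mxrank n (w : 'cV[R[i]]_n) : (\rank (w *m w^t*) == 1%N) = (w != 0).
Proof.
apply/idP/idP => [|w0].
  by apply: contraTneq => ->; rewrite mul0mx mxrank0.
rewrite eqn_leq (leq_trans (mxrankM_maxl _ _)) ?rank_leq_col // lt0n mxrank_eq0.
apply: contra_neq w0 => W0; apply: dot_eq0; apply: Normc.eq0_normc; apply/eqP.
rewrite -sqrf_eq0 -/(gain w w) -qform_rank1 W0.
by rewrite /qform mul0mx /dot mulmx0 mxE.
Qed.

Lemma trace_rank1 n (w : 'cV[R[i]]_n) : \tr (w *m w^t*) = (w^t* *m w) 0 0.
Proof. by rewrite mxtrace_mulC trace_mx11. Qed.

Lemma psd_rank1 n (w : 'cV[R[i]]_n) : psd (w *m w^t*).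
Proof. by apply/psdP => [|x]; rewrite ?hermsymmx_rank1 // qform_rank1 gain_ge0. Qed.

Lemma qform_le1 n (B : 'M[R[i]]_n) e : B \is hermsymmx ->
  ((e^t* *m B *m e) 0 0 <= 1) = (qform B e <= 1).
Proof. by move=> hB; rewrite qform_mx // mxE eqxx mulr1n -lecR. Qed.
End Constraints.

(** * Equivalence of the robust problem and the rank-constrained program *)

Section Robust.
Context {R : realType} (K N : nat).
Local Notation normc := (@Normc.normc R).
Variables (h : 'I_K -> 'I_K -> 'cV[R[i]]_N) (B : 'I_K -> 'I_K -> 'M[R[i]]_N).
Variables (sigma delta gamma eta zeta : 'I_K -> R).
Hypothesis hB : forall i j, psd (B i j).
Hypothesis hsigma : forall i, 0 < sigma i.
Hypothesis hdelta : forall i, 0 < delta i.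
Hypothesis hgamma : forall i, 0 < gamma i.
Hypothesis heta : forall i, 0 < eta i.
Variables (w : 'I_K -> 'cV[R[i]]_N) (rho : 'I_K -> R).

Let hermB i j : B i j \is hermsymmx. Proof. exact: (proj1 (hB i j)). Qed.

(** At [rho i = 0] the ratio is 0 by convention, below [gamma i], so the constraint itself forces
    [rho i] to be positive. *)
Lemma sinr_geE (g : 'I_K -> 'I_K -> 'cV[R[i]]_N) i : 0 <= rho i ->
  gamma i <= sinr g sigma delta w rho i <->
  0 < rho i /\ gamma i * (\sum_(j < K | j != i) gain (g i j) (w j)
    + sigma i ^+ 2 + delta i ^+ 2 / rho i) <= gain (g i i) (w i).
Proof.
move=> r0; rewrite /sinr; have [->|rn0] := eqVneq.
  by rewrite leNgt hgamma ltxx; split=> // -[].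
have rp : 0 < rho i by rewrite lt_def rn0.
rewrite ler_pdivlMr; first by split=> [|[]].
rewrite ltr_wpDr ?divr_ge0 ?sqr_ge0 // ltr_wpDl ?exprn_gt0 //.
by apply: sumr_ge0 => j _; exact: gain_ge0.
Qed.

(** Each gain lies between its [tund] and [tbar], and both constraints are monotone in the gains
    that these replace. *)
Lemma P1_of_P2 nu lambda mu tbar tund : (forall i, 0 < zeta i) ->
  P2_feasible h B sigma delta gamma eta zeta
    (fun i => w i *m (w i)^t*) rho nu lambda mu tbar tund ->
  P1_feasible h B sigma delta gamma eta zeta w rho.
Proof.
move=> hzeta [hs hu he hl [pos nu0 rho01 _ _]]; split=> // i e he1.
have {}he1 j : qform (B i j) (e j) <= 1 by rewrite -qform_le1.
have /andP[r0 r1] := rho01 i; split.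
  apply/sinr_geE => //.
  have [rp le] := sinr_bound (hermB i i) (hgamma i) (hdelta i) r0 (nu0 i) (hs i) (he1 i).
  split=> //; apply: le_trans le; rewrite ler_pM2l // !lerD2r.
  apply: ler_sum => j _; have [l0 _ _ _] := pos i j.
  exact: upper_bound (hu i j) _ _.
have t0 : 0 <= \sum_j tund i j by apply: sumr_ge0 => j _; case: (pos i j).
have /energy_psd := he i; rewrite ltr_wpDl ?exprn_gt0 // => /(_ (heta i) isT).
move=> /le_trans; apply; rewrite ler_wpM2l ?mulr_ge0 ?subr_ge0 ?(ltW (hzeta i)) //.
rewrite lerD2r; apply: ler_sum => j _; have [_ m0 _ _] := pos i j.
exact: lower_bound (hl i j) _ _.
Qed.

Section Necessity.
Hypothesis P1 : P1_feasible h B sigma delta gamma eta zeta w rho.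

Let rho0 i : 0 <= rho i. Proof. by case/andP: (P1.1 i). Qed.

Let P1e i (e : 'I_K -> 'cV[R[i]]_N) : (forall j, qform (B i j) (e j) <= 1) ->
  [/\ 0 < rho i,
    gamma i * (\sum_(j < K | j != i) gain (h i j + e j) (w j)
      + sigma i ^+ 2 + delta i ^+ 2 / rho i) <= gain (h i i + e i) (w i) &
    eta i <= zeta i * (1 - rho i) * (\sum_(j < K) gain (h i j + e j) (w j) + sigma i ^+ 2)].
Proof.
move=> e1; have {}e1 j : ((e j)^t* *m B i j *m e j) 0 0 <= 1 by rewrite qform_le1.
by have [/sinr_geE-/(_ (rho0 i))[? ?] ?] := P1.2 i e e1.
Qed.

Let qform0_le1 i j : qform (B i j) 0 <= 1.
Proof. by rewrite /qform mulmx0 /dot mulmx0 mxE ler01. Qed.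

Lemma robust_gain_gt0 i (e : 'I_K -> 'cV[R[i]]_N) :
  (forall j, qform (B i j) (e j) <= 1) -> 0 < gain (h i i + e i) (w i).
Proof.
move=> /P1e[rp + _]; apply: lt_le_trans; rewrite pmulr_rgt0 //.
rewrite ltr_wpDr ?divr_ge0 ?sqr_ge0 // ltr_wpDl ?exprn_gt0 //.
by apply: sumr_ge0 => j _; exact: gain_ge0.
Qed.

Lemma beam_neq0 i : w i != 0.
Proof.
have := @robust_gain_gt0 i (fun=> 0) (qform0_le1 i).
by apply: contraTneq => ->; rewrite /gain mulmx0 mxE Normc.normc0 expr0n ltxx.
Qed.

(* An error in the kernel of [B i j] can be scaled freely, so if it were not
   orthogonal to [w j] it could cancel the useful signal ([j = i]) or make the
   interference arbitrarily large ([j != i]). *)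
Lemma beam_in_range i j : exists v, w j = B i j *m v.
Proof.
have [//|[e0 Be0 de0]] := range_or_kernel (w j) (hermB i j); exfalso.
pose G := gain (h i i + 0) (w i).
(* The square of [G / gamma i + 1] exceeds [G / gamma i], so this single interference term already
   violates the SINR constraint. *)
pose z : R[i] := if j == i then 0 else (G / gamma i + 1)%:C.
have [e1 qe1 dz] := gain_kernel (h i j) z Be0 de0.
pose e k := if k == j then e1 else 0.
have qe k : qform (B i k) (e k) <= 1.
  by rewrite /e; case: eqP => [->|_] //; exact: qform0_le1.
have gz : gain (h i j + e j) (w j) = normc z ^+ 2.
  by rewrite /gain -/(dot _ _) /e eqxx dz.
have [ji|ji] := eqVneq j i.
  have := robust_gain_gt0 qe; move: gz; rewrite /z ji eqxx => ->.
  by rewrite Normc.normc0 expr0n ltxx.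
have [rp + _] := P1e qe.
have -> : gain (h i i + e i) (w i) = G by rewrite /e eq_sym (negbTE ji).
apply/negP; rewrite -ltNge mulrC -ltr_pdivrMr //.
rewrite (bigD1 j) //= gz /z (negbTE ji) normc2_real.
have G0 : 0 <= G / gamma i by rewrite divr_ge0 ?gain_ge0 // ltW.
rewrite -!addrA ltr_wpDr //; last by nra.
rewrite addr_ge0 ?addr_ge0 ?divr_ge0 ?sqr_ge0 //.
by apply: sumr_ge0 => k _; exact: gain_ge0.
Qed.

Lemma P2_of_P1 : exists (nu : 'I_K -> R) (lambda mu tbar tund : 'I_K -> 'I_K -> R),
  P2_feasible h B sigma delta gamma eta zeta
       (fun i => w i *m (w i)^t*) rho nu lambda mu tbar tund.
Proof.
have mx i j : exists lt : R * R, [/\ 0 <= lt.1, 0 <= lt.2,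
    psd (upper_lmi (h i j) (B i j) (w j *m (w j)^t*) lt.1 lt.2) &
    exists2 e, qform (B i j) e <= 1 & gain (h i j + e) (w j) = lt.2].
  have [v wE] := beam_in_range i j.
  exact: max_gain_dual (hB i j) wE (beam_neq0 j).
have mn i j : exists mt : R * R, [/\ 0 <= mt.1, 0 <= mt.2,
    forall x s, (mt.2 + mt.1) * normc s ^+ 2 <=
      gain (x + s *: h i j) (w j) + mt.1 * qform (B i j) x &
    exists2 e, qform (B i j) e <= 1 & gain (h i j + e) (w j) = mt.2].
  have [v wE] := beam_in_range i j.
  exact: min_gain_dual (hB i j) wE (beam_neq0 j).
(* Finite choice gathers the multipliers, and below the extremal errors, into families indexed by
   receiver and transmitter. *)
have [lt ltP] := fin_all_exists (fun i => fin_all_exists (mx i)).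
have [mt mtP] := fin_all_exists (fun i => fin_all_exists (mn i)).
have amax i j : exists e, qform (B i j) e <= 1 /\ gain (h i j + e) (w j) = (lt i j).2.
  by have [_ _ _ [e]] := ltP i j; exists e.
have [emax emaxP] := fin_all_exists (fun i => fin_all_exists (amax i)).
have amin i j : exists e, qform (B i j) e <= 1 /\ gain (h i j + e) (w j) = (mt i j).2.
  by have [_ _ _ [e]] := mtP i j; exists e.
have [emin eminP] := fin_all_exists (fun i => fin_all_exists (amin i)).
exists (fun i => (mt i i).1 / gamma i), (fun i j => (lt i j).1),
  (fun i j => (mt i j).1), (fun i j => (lt i j).2), (fun i j => (mt i j).2).
split=> [i|i j|i|i j|].
(* The worst case for the SINR: the useful channel at its minimum and every interfering channel at
   its maximum, in one error family. *)
- have [|rp + _] := @P1e i (fun j => if j == i then emin i j else emax i j).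
    by move=> j; case: ifP => _; [case: (eminP i j) | case: (emaxP i j)].
  rewrite eqxx (eminP i i).2 => le.
  have [_ _ fm _] := mtP i i.
  apply: sinr_lmi_of_min fm _ => //; apply: le_trans le.
  rewrite ler_pM2l // !lerD2r; apply: ler_sum => j ji.
  by rewrite (negbTE ji) (emaxP i j).2.
- by have [] := ltP i j.
(* The worst case for harvesting: all channels at their minimum simultaneously. *)
- have [|_ _] := @P1e i (emin i) => [j|]; first by case: (eminP i j).
  under eq_bigr do rewrite (eminP i _).2.
  move=> le; apply/energy_psd => //.
  rewrite ltr_wpDl ?exprn_gt0 //; apply: sumr_ge0 => j _.
  by have [] := mtP i j.
- by have [_ _ fm _] := mtP i j; apply/lower_lmiP.
split=> [i j|i|i|i|i].
- by have [] := ltP i j; have [] := mtP i j.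
- by have [m0 _ _ _] := mtP i i; rewrite divr_ge0 // ltW.
- exact: P1.1.
- exact: psd_rank1.
- by apply/eqP; rewrite rank1_mxrank beam_neq0.
Qed.

End Necessity.
End Robust.

Unset Implicit Arguments.
Theorem mainTheorem1 (R : realType) (K N : nat)
    (hK : (2 <= K)%N) (hN : (2 <= N)%N)
    (h : 'I_K -> 'I_K -> 'cV[R[i]]_N) (B : 'I_K -> 'I_K -> 'M[R[i]]_N)
    (sigma delta gamma eta zeta : 'I_K -> R)
    (hB : forall i j, psd (B i j))
    (hsigma : forall i, 0 < sigma i) (hdelta : forall i, 0 < delta i)
    (hgamma : forall i, 0 < gamma i) (heta : forall i, 0 < eta i)
    (hzeta : forall i, 0 < zeta i <= 1)
    (w : 'I_K -> 'cV[R[i]]_N) (rho : 'I_K -> R) :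
  (P1_feasible h B sigma delta gamma eta zeta w rho <->
   exists (nu : 'I_K -> R) (lambda mu tbar tund : 'I_K -> 'I_K -> R),
     P2_feasible h B sigma delta gamma eta zeta
       (fun i => w i *m (w i)^t*) rho nu lambda mu tbar tund) /\
  P1_objective w = P2_objective (fun i => w i *m (w i)^t*).
Proof.
split; last by apply: eq_bigr => i _; rewrite trace_rank1.
split=> [|[nu [lambda [mu [tbar [tund]]]]]]; first exact: P2_of_P1.
by apply: P1_of_P2 => // i; have /andP[] := hzeta i.
Qed.
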